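(* Let $R$ be a commutative ring with non-zero identity and let $G$ be an abelian group (written multiplicatively). The group ring $RG$ is weakly nil-neat if and only if exactly one of the following four conditions is satisfied: (1) $G$ is trivial and $R$ is weakly nil-neat; (2) $G$ is non-trivial, $G$ is a torsion $2$-group, and $R$ is nil-clean (in fact, $R/N(R)$ is boolean); (3) $G$ is non-trivial, $G$ is a torsion $3$-group, and $R$ is weakly nil-clean with $3\in N(R)$ (in fact, $R/N(R)$ is isomorphic to $\mathbb{Z}_3$); (4) $G$ is cyclic of order $2$ and $R\cong \mathbb{Z}_3$.
   Context: All rings are commutative with non-zero identity and all groups are abelian, written multiplicatively. $RG$ denotes the group ring of $G$ over $R$, and $N(R)$ denotes the nil-radical of $R$ (the set of nilpotent elements). $\mathbb{Z}_3$ is the field of three elements. For a prime $p$, $G_p$ denotes the $p$-torsion component of $G$ (the elements whose order is a power of $p$); $G$ is a (torsion) $p$-group if $G=G_p$. A ring is boolean if $x^2=x$ for all its elements $x$. A ring $R$ is nil-clean if each element of $R$ is a sum $n+e$ of a nilpotent $n\in R$ and an idempotent $e\in R$. A ring $R$ is weakly nil-clean if each element of $R$ can be written as $n+e$ or $n-e$ with $n\in R$ nilpotent and $e\in R$ idempotent. A ring $R$ is weakly nil-neat if every proper homomorphic image of $R$ is weakly nil-clean, i.e. $R/I$ is weakly nil-clean for every ideal $I$ of $R$ with $0\neq I\neq R$ (in particular, every field is weakly nil-neat). *)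

(* Defs.v *)
From HB Require Import structures.
From mathcomp Require Import all_boot all_algebra finmap.
From mathcomp.multinomials Require Import monalg.
From mathcomp Require Import boolp.

Set Implicit Arguments.
Unset Strict Implicit.
Unset Printing Implicit Defensive.

Import GRing.Theory.
Local Open Scope fset_scope.
Local Open Scope ring_scope.

HB.mixin Record Group_isAbelian G of Group G := {
  abelian_mulgC : forall x y : G, (x * y)%g = (y * x)%g
}.

(* Abelian groups, possibly infinite, in multiplicative notation. *)
#[short(type="abGroupType")]
HB.structure Definition AbGroup := {G of Group_isAbelian G & Group G}.

(* The ring instance that monalg puts on {malg R[K]} asks that K have no
   nontrivial unit, which excludes groups.  Hence an alias, which keeps the
   additive structure of the finitely supported functions from G to R and
   carries the convolution product. *)
Definition group_ring (R : comNzRingType) (G : abGroupType) : Type :=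
  {malg R[G]}.

Section GroupRing.
Context (R : comNzRingType) (G : abGroupType).
Implicit Types (a b c : {malg R[G]}) (x y : G) (d : {fset G}).

HB.instance Definition _ := GRing.Zmodule.copy (group_ring R G) {malg R[G]}.

Definition gr_one : {malg R[G]} := << 1%g >>.

Definition gr_mul a b : {malg R[G]} :=
  \sum_(x <- msupp a) \sum_(y <- msupp b) << a@_x * b@_y *g (x * y)%g >>.

Lemma gr_mulw d1 d2 a b : msupp a `<=` d1 -> msupp b `<=` d2 ->
  gr_mul a b =
  \sum_(x <- d1) \sum_(y <- d2) << a@_x * b@_y *g (x * y)%g >>.
Proof.
move=> le1 le2; rewrite /gr_mul (big_fset_incl _ le1) /=.
  apply: eq_bigr => x _; apply/big_fset_incl => // y _ /mcoeff_outdom ->.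
  by rewrite mulr0 monalgU0.
move=> x _ /mcoeff_outdom ax.
by rewrite big1 // => y _; rewrite ax mul0r monalgU0.
Qed.

Lemma gr_mulC : commutative gr_mul.
Proof.
move=> a b; rewrite /gr_mul exchange_big; apply: eq_bigr => y _.
by apply: eq_bigr => x _; rewrite mulrC abelian_mulgC.
Qed.

Lemma gr_mul0 a : gr_mul 0 a = 0.
Proof. by rewrite /gr_mul msupp0 big_seq_fset0. Qed.

Lemma gr_mulDl : left_distributive gr_mul +%R.
Proof.
move=> a b c; pose d := msupp a `|` msupp b.
rewrite (gr_mulw (msuppD_le a b) (fsubset_refl (msupp c))).
rewrite (gr_mulw (fsubsetUl _ _ : _ `<=` d) (fsubset_refl (msupp c))).
rewrite (gr_mulw (fsubsetUr _ _ : _ `<=` d) (fsubset_refl (msupp c))).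
rewrite -big_split; apply: eq_bigr => x _.
rewrite -big_split; apply: eq_bigr => y _.
by rewrite mcoeffD mulrDl monalgUD.
Qed.

Lemma gr_mulDr : right_distributive gr_mul +%R.
Proof. by move=> a b c; rewrite !(gr_mulC a) gr_mulDl. Qed.

Lemma gr_mulUl (r : R) x b :
  gr_mul << r *g x >> b = \sum_(y <- msupp b) << r * b@_y *g (x * y)%g >>.
Proof.
rewrite (gr_mulw msuppU_le (fsubset_refl _)) big_seq_fset1.
by apply: eq_bigr => y _; rewrite mcoeffUU.
Qed.

Lemma gr_mulUU (r s : R) x y :
  gr_mul << r *g x >> << s *g y >> = << r * s *g (x * y)%g >>.
Proof. by rewrite (gr_mulw msuppU_le msuppU_le) !big_seq_fset1 !mcoeffUU. Qed.

Lemma gr_mul_suml (I : Type) (s : seq I) (F : I -> {malg R[G]}) b :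
  gr_mul (\sum_(i <- s) F i) b = \sum_(i <- s) gr_mul (F i) b.
Proof.
exact: (big_morph (gr_mul^~ b) (fun u v => gr_mulDl u v b) (gr_mul0 b)).
Qed.

Lemma gr_mul_sumr (I : Type) (s : seq I) (F : I -> {malg R[G]}) a :
  gr_mul a (\sum_(i <- s) F i) = \sum_(i <- s) gr_mul a (F i).
Proof.
by rewrite gr_mulC gr_mul_suml; apply: eq_bigr => i _; rewrite gr_mulC.
Qed.

Lemma gr_mulA : associative gr_mul.
Proof.
move=> a b c; rewrite [a]monalgE !gr_mul_suml; apply: eq_bigr => x _.
rewrite [b]monalgE gr_mul_suml !gr_mul_sumr gr_mul_suml.
apply: eq_bigr => y _; rewrite [c]monalgE !gr_mul_sumr.
by apply: eq_bigr => z _; rewrite !gr_mulUU mulrA mulgA.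
Qed.

Lemma gr_mul1 : left_id gr_one gr_mul.
Proof.
move=> a; rewrite gr_mulUl [RHS]monalgE.
by apply: eq_bigr => x _; rewrite mul1r mul1g.
Qed.

Lemma gr_one_neq0 : gr_one != 0.
Proof. by rewrite monalgU_eq0 oner_eq0. Qed.

HB.instance Definition _ := GRing.Zmodule_isComNzRing.Build (group_ring R G)
  gr_mulA gr_mulC gr_mul1 gr_mulDl gr_one_neq0.

End GroupRing.

Definition nilpotent_elt (R : comNzRingType) (x : R) : Prop :=
  exists n : nat, x ^+ n = 0.

Definition idempotent_elt (R : comNzRingType) (x : R) : Prop := x * x = x.

Definition nil_clean (R : comNzRingType) : Prop :=
  forall x : R, exists n e : R,
    [/\ nilpotent_elt n, idempotent_elt e & x = n + e].

Definition weakly_nil_clean (R : comNzRingType) : Prop :=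
  forall x : R, exists n e : R,
    [/\ nilpotent_elt n, idempotent_elt e & x = n + e \/ x = n - e].

(* An I : idealr R never contains 1; excluded middle makes the booleanity of
   its membership predicate harmless. *)
Definition weakly_nil_neat (R : comNzRingType) : Prop :=
  forall I : idealr R, (exists2 x : R, x \in I & x != 0) ->
    weakly_nil_clean {ideal_quot I}.

Definition boolean_ring (R : comNzRingType) : Prop :=
  forall x : R, x ^+ 2 = x.

Definition ring_isomorphic (R S : comNzRingType) : Prop :=
  exists f : {rmorphism R -> S}, bijective f.

Section Nilradical.
Context (R : comNzRingType).

Definition nilradical : {pred R} := fun x => `[< nilpotent_elt x >].

Lemma nilradical_idealr : idealr_closed nilradical.
Proof.
split; first by apply/asboolP; exists 1%N; rewrite expr1.
  by apply/asboolP => -[n /eqP]; rewrite expr1n oner_eq0.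
move=> a x y /asboolP[m xm] /asboolP[n yn]; apply/asboolP; exists (m + n)%N.
rewrite exprDn big1 // => i _; case: (leqP n i) => [le_ni | lt_in].
  by rewrite -(subnK le_ni) exprD yn !mulr0 mul0rn.
have le_m : (m <= m + n - i)%N by rewrite -addnBA ?leq_addr // ltnW.
by rewrite exprMn -(subnK le_m) [x ^+ _]exprD xm !(mulr0, mul0r) mul0rn.
Qed.

HB.instance Definition _ := isIdealr.Build R nilradical nilradical_idealr.

End Nilradical.

Arguments nilradical : clear implicits.

Definition trivial_group (G : groupType) : Prop := forall g : G, g = 1%g.

Definition has_order (G : groupType) (g : G) (n : nat) : Prop :=
  [/\ (0 < n)%N, (g ^+ n)%g = 1%g
    & forall m : nat, (0 < m)%N -> (g ^+ m)%g = 1%g -> (n <= m)%N].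

Definition in_torsion_component (p : nat) (G : groupType) (g : G) : Prop :=
  exists k : nat, has_order g (p ^ k).

Definition torsion_p_group (p : nat) (G : groupType) : Prop :=
  forall g : G, in_torsion_component p g.

Definition cyclic_of_order (n : nat) (G : groupType) : Prop :=
  exists g : G, has_order g n /\
    forall h : G, exists k : nat, h = (g ^+ k)%g \/ h = (g ^- k)%g.

Definition neat_case1 (R : comNzRingType) (G : abGroupType) : Prop :=
  trivial_group G /\ weakly_nil_neat R.

Definition neat_case2 (R : comNzRingType) (G : abGroupType) : Prop :=
  [/\ ~ trivial_group G, torsion_p_group 2 G & nil_clean R].

Definition neat_case3 (R : comNzRingType) (G : abGroupType) : Prop :=
  [/\ ~ trivial_group G, torsion_p_group 3 G, weakly_nil_clean R
    & (3%:R : R) \in nilradical R].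

Definition neat_case4 (R : comNzRingType) (G : abGroupType) : Prop :=
  cyclic_of_order 2 G /\ ring_isomorphic R 'F_3.

Definition exactly_one (Ps : seq Prop) : Prop :=
  exists! i : 'I_(size Ps), nth False Ps i.

(* Main.v *)
(* If [RG] is weakly nil-neat and [G] is non-trivial, the augmentation makes [R]
   weakly nil-clean, so 6 is nilpotent in [R].  In any quotient of [RG] by a
   nonzero proper principal ideal [(c)], units are congruent to 1 or -1 modulo
   nilpotents.  When 2 is nilpotent this gives [g - 1] in the radical of [(c)]
   for every [g] in [G]; when 3 is nilpotent it gives [g^2 - 1].  Taking
   [c = h^(p+1) - 1] shows that [h = g], respectively [h = g^2], has finite
   order, and then the norm [c = 1 + h + ... + h^(n-1)], which annihilates
   [h - 1], shows that [h - 1] is nilpotent, so that the order of [h] is a power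
   of [p].  For [p = 3] an involution [t] puts [t - 1] or [t + 1] in every
   nonzero proper principal ideal; ideals generated by scalars then force [R]
   to be a field, and ideals generated by [g - 1] force [G = {1, t}].
   Conversely, when [p] is nilpotent in [R] and [G] is a [p]-group, the
   augmentation ideal is nil and [RG] inherits weak nil-cleanness from [R]. *)

Require Import Defs.
From HB Require Import structures.
From mathcomp Require Import all_boot all_algebra.
From mathcomp Require Import finmap boolp ring.
From mathcomp.multinomials Require Import monalg.

Set Implicit Arguments.
Unset Strict Implicit.
Unset Printing Implicit Defensive.

Import GRing.Theory.

(** * Ideals, quotients and weakly nil-clean commutative rings *)

Section RingLemmas.
Local Open Scope ring_scope.

Lemma nilradicalP (A : comNzRingType) (x : A) :
  reflect (nilpotent_elt x) (x \in nilradical A).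
Proof. exact: asboolP. Qed.

Lemma nilradical_mulr (A : comNzRingType) (x y : A) :
  x \in nilradical A -> x * y \in nilradical A.
Proof. by move=> xN; rewrite mulrC; apply: idealMr. Qed.

Lemma nilradical_morph (A B : comNzRingType) (f : {rmorphism A -> B}) x :
  x \in nilradical A -> f x \in nilradical B.
Proof.
by move=> /nilradicalP[k xk]; apply/nilradicalP; exists k; rewrite -rmorphXn xk rmorph0.
Qed.

Definition ideal_pi (A : comNzRingType) (I : idealr A) :
  {rmorphism A -> {ideal_quot I}} := \pi_({ideal_quot I})%qT.

Lemma ideal_pi_surj (A : comNzRingType) (I : idealr A) (b : {ideal_quot I}) :
  exists a, ideal_pi I a = b.
Proof. by exists (repr b); rewrite /ideal_pi /= reprK. Qed.

Lemma ideal_pi_eq0 (A : comNzRingType) (I : idealr A) (x : A) :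
  (ideal_pi I x = 0) <-> (x \in I).
Proof.
rewrite -(rmorph0 (ideal_pi I)) -[x in x \in I]subr0 Quotient.idealrBE.
by split=> /eqP.
Qed.

(** Packs a [Prop]-valued predicate as a bundled ideal; [~ P 1] is there because an [idealr] is
    proper by definition. *)
Lemma idealr_exists (A : comNzRingType) (P : A -> Prop) :
  P 0 -> ~ P 1 -> (forall a u v, P u -> P v -> P (a * u + v)) ->
  exists I : idealr A, forall x, (x \in I) <-> P x.
Proof.
move=> P0 P1 PD; pose J : {pred A} := fun x => `[< P x >].
have cJ : idealr_closed J.
  split; first exact/asboolP; first exact/asboolP.
  by move=> a u v /asboolP Pu /asboolP Pv; apply/asboolP; apply: PD.
pose m := isIdealr.Build A J cJ.
pose I : idealr A := HB.pack J m.
by exists I => x; split => /asboolP.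
Qed.

(** [B] is a quotient of [C], but the induced map is never built: the two summands in [C] are lifted
    along [p] and pushed forward by [f], which is harmless because [f] vanishes on the kernel of
    [p]. *)
Lemma weakly_nil_clean_image (A B C : comNzRingType)
    (p : {rmorphism A -> C}) (f : {rmorphism A -> B}) :
  (forall c, exists a, p a = c) -> (forall b, exists a, f a = b) ->
  (forall a, p a = 0 -> f a = 0) ->
  weakly_nil_clean C -> weakly_nil_clean B.
Proof.
move=> psurj fsurj pf Cwnc b; have [x <-] := fsurj b.
have [n [e [[k nk] ee xne]]] := Cwnc (p x).
have [n' pn] := psurj n; have [e' pe] := psurj e.
have f_eq y z : p y = p z -> f y = f z.
  move=> pyz; apply/eqP; rewrite -subr_eq0 -rmorphB; apply/eqP/pf.
  by rewrite rmorphB pyz subrr.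
exists (f n'), (f e'); split.
- by exists k; rewrite -rmorphXn pf // rmorphXn pn.
- by rewrite /idempotent_elt -rmorphM; apply: f_eq; rewrite rmorphM pe.
- rewrite -rmorphD -rmorphB.
  by case: xne => xne; [left | right]; apply: f_eq; rewrite ?rmorphB ?rmorphD xne pn pe.
Qed.

(** The kernel of [f] is a nonzero proper ideal, and [B] is the quotient by it. *)
Lemma weakly_nil_neat_noninjective (A B : comNzRingType)
    (f : {rmorphism A -> B}) (a0 : A) :
  (forall b, exists a, f a = b) -> a0 != 0 -> f a0 = 0 ->
  weakly_nil_neat A -> weakly_nil_clean B.
Proof.
move=> fsurj a0n0 fa0 Aneat.
have [|||I IP] := @idealr_exists A (fun x => f x = 0).
- exact: rmorph0.
- by rewrite rmorph1; apply/eqP/oner_neq0.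
- by move=> a u v fu fv; rewrite rmorphD rmorphM fu fv mulr0 addr0.
apply: (weakly_nil_clean_image (p := ideal_pi I) (f := f)) => //.
- exact: ideal_pi_surj.
- by move=> a /ideal_pi_eq0/IP.
- by apply: Aneat; exists a0 => //; apply/IP.
Qed.

Lemma weakly_nil_neat_image (A B : comNzRingType) (f : {rmorphism A -> B}) :
  (forall b, exists a, f a = b) -> weakly_nil_neat A -> weakly_nil_neat B.
Proof.
move=> fsurj Aneat I [b bI bn0].
have [a fa] := fsurj b.
apply: (@weakly_nil_neat_noninjective _ _ (ideal_pi I \o f) a) => //.
- by move=> c; have [y <-] := ideal_pi_surj c; have [x <-] := fsurj y; exists x.
- by apply: contraNneq bn0 => a0; rewrite -fa a0 rmorph0.
- by apply/ideal_pi_eq0; rewrite fa.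
Qed.

Lemma weakly_nil_clean_neat (A : comNzRingType) :
  weakly_nil_clean A -> weakly_nil_neat A.
Proof.
move=> Awnc I _.
apply: (@weakly_nil_clean_image A _ A idfun (ideal_pi I)) => //.
- by move=> c; exists c.
- exact: ideal_pi_surj.
- by move=> a /= ->; rewrite rmorph0.
Qed.

Lemma nil_clean_weakly (A : comNzRingType) :
  nil_clean A -> weakly_nil_clean A.
Proof.
by move=> Anc x; have [n [e [? ? ?]]] := Anc x; exists n, e; split=> //; left.
Qed.

(** [n - e = (n - 2e) + e], and [n - 2e] is nilpotent as soon as 2 is. *)
Lemma weakly_nil_clean_nil_clean (A : comNzRingType) :
  2%:R \in nilradical A -> weakly_nil_clean A -> nil_clean A.
Proof.
move=> nil2 Awnc x; have [n [e [/nilradicalP nn ee xne]]] := Awnc x.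
case: xne => ->; first by exists n, e; split=> //; apply/nilradicalP.
exists (n - 2%:R * e), e; split=> //; last by ring.
by apply/nilradicalP; rewrite rpredB ?nilradical_mulr.
Qed.

(** Modulo the nilradical [x] is [e] or [-e], hence a root of [X^2 - X] or of [X^2 + X]. *)
Lemma weakly_nil_clean_split (A : comNzRingType) (x : A) :
  weakly_nil_clean A ->
  x * (x - 1) \in nilradical A \/ x * (x + 1) \in nilradical A.
Proof.
move=> /(_ x)[n [e [/nilradicalP nn ee xne]]].
case: xne => ->; [left | right].
  have -> : (n + e) * (n + e - 1) = n * (n + 2%:R * e - 1) + (e * e - e) by ring.
  by rewrite ee subrr addr0 nilradical_mulr.
have -> : (n - e) * (n - e + 1) = n * (n - 2%:R * e + 1) + (e * e - e) by ring.
by rewrite ee subrr addr0 nilradical_mulr.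
Qed.

Lemma weakly_nil_clean_unit (A : comNzRingType) (u v : A) :
  weakly_nil_clean A -> u * v = 1 ->
  u - 1 \in nilradical A \/ u + 1 \in nilradical A.
Proof.
move=> Awnc uv; case: (weakly_nil_clean_split u Awnc) => uN; [left | right].
  have -> : u - 1 = u * (u - 1) * v by rewrite mulrAC uv mul1r.
  exact: nilradical_mulr.
have -> : u + 1 = u * (u + 1) * v by rewrite mulrAC uv mul1r.
exact: nilradical_mulr.
Qed.

(** At [x = 2] the two products of [weakly_nil_clean_split] are 2 and 6. *)
Lemma weakly_nil_clean_nil6 (A : comNzRingType) :
  weakly_nil_clean A -> 6%:R \in nilradical A.
Proof.
move=> Awnc; case: (weakly_nil_clean_split 2%:R Awnc) => h.
  have -> : 6%:R = 2%:R * (2%:R - 1) * 3%:R :> A by ring.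
  exact: nilradical_mulr.
by have -> : 6%:R = 2%:R * (2%:R + 1) :> A by ring.
Qed.

Lemma weakly_nil_neat_principal (A : comNzRingType) (c : A) :
  weakly_nil_neat A -> c != 0 -> (forall y, y * c <> 1) ->
  exists (B : comNzRingType) (f : {rmorphism A -> B}),
    weakly_nil_clean B /\ (forall x, f x = 0 <-> exists y, x = y * c).
Proof.
move=> Aneat cn0 cnu.
have [|||I IP] := @idealr_exists A (fun x => exists y, x = y * c).
- by exists 0; rewrite mul0r.
- by case=> y /esym /cnu.
- by move=> a _ _ [y ->] [z ->]; exists (a * y + z); rewrite mulrDl mulrA.
exists {ideal_quot I}, (ideal_pi I); split.
  by apply: Aneat; exists c => //; apply/IP; exists 1; rewrite mul1r.
by move=> x; rewrite ideal_pi_eq0 IP.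
Qed.

(** Some power [3^k] is odd and vanishes in [A]; writing it as [1 + 2m] gives the inverse [-m] of
    2. *)
Lemma nil3_half (A : comNzRingType) :
  3%:R \in nilradical A -> exists w : A, 2%:R * w = 1.
Proof.
move=> /nilradicalP[k]; rewrite -natrX => h.
exists (- ((3 ^ k)./2)%:R); rewrite mulrN -natrM mul2n.
have o : odd (3 ^ k) by rewrite oddX orbT.
move: h; rewrite -{1}[(3 ^ k)%N]odd_double_half o natrD => /eqP.
by rewrite addr_eq0 => /eqP <-.
Qed.

(** By induction [x^(n+1) = a^n x], so a vanishing power of [x] kills [x] itself, [a] being a
    unit. *)
Lemma nilpotent_eigen_eq0 (A : comNzRingType) (a b x : A) :
  a * b = 1 -> x * x = a * x -> x \in nilradical A -> x = 0.
Proof.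
move=> ab xx /nilradicalP[k xk].
have xS n : x ^+ n.+1 = a ^+ n * x.
  elim: n => [|n IH]; first by rewrite expr1 mul1r.
  by rewrite exprS IH mulrCA xx mulrA -exprSr.
have := xS k; rewrite exprS xk mulr0 => /esym ax0.
by rewrite -[x]mul1r -(expr1n A k) -ab exprMn mulrAC ax0 mul0r.
Qed.

(** [(u - 1)^2 = -2(u - 1)], and [-2] has the inverse [-w]. *)
Lemma square_root_of_one (A : comNzRingType) (u w : A) :
  2%:R * w = 1 -> u * u = 1 -> u - 1 \in nilradical A -> u = 1.
Proof.
move=> w2 uu uN; apply/eqP; rewrite -subr_eq0; apply/eqP.
apply: (nilpotent_eigen_eq0 (a := - 2%:R) (b := - w)) uN; first by rewrite mulrNN.
have -> : (u - 1) * (u - 1) = u * u - 2%:R * u + 1 by ring.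
by rewrite uu; ring.
Qed.

Lemma ring_isomorphic_F3 (A : comNzRingType) :
  3%:R = 0 :> A -> (forall x : A, [\/ x = 0, x = 1 | x = -1]) ->
  ring_isomorphic A 'F_3.
Proof.
move=> h3 A3.
have n10 : -1 != 0 :> A by rewrite oppr_eq0 oner_neq0.
have d1 : 1 + 1 = -1 :> A by apply/eqP; rewrite -addr_eq0 -h3; apply/eqP; ring.
have n11 : -1 != 1 :> A.
  apply: contraNneq (oner_neq0 A) => h.
  by rewrite -(addrK 1 (1 : A)) d1 {1}h subrr.
pose f (x : A) : 'F_3 := if x == 0 then 0 else if x == 1 then 1 else -1.
have f0 : f 0 = 0 by rewrite /f eqxx.
have f1 : f 1 = 1 by rewrite /f oner_eq0 eqxx.
have fN : f (-1) = -1 by rewrite /f (negPf n10) (negPf n11).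
have dN : -1 - 1 = 1 :> A by rewrite -opprD d1 opprK.
have fB : zmod_morphism f.
  move=> x y; case: (A3 x) => ->; case: (A3 y) => ->;
    rewrite ?oppr0 ?addr0 ?opprK ?add0r ?addNr ?subrr ?d1 ?dN ?f0 ?f1 ?fN;
    by apply/val_inj.
have fM : monoid_morphism f.
  split=> // x y; case: (A3 x) => ->; case: (A3 y) => ->;
    rewrite ?mulr0 ?mul0r ?mulr1 ?mul1r ?mulrN1 ?opprK ?f0 ?f1 ?fN;
    by apply/val_inj.
pose fm : {rmorphism A -> 'F_3} := HB.pack f (GRing.isZmodMorphism.Build _ _ f fB)
  (GRing.isMonoidMorphism.Build _ _ f fM).
exists fm; pose g (z : 'F_3) : A := if z == 0 then 0 else if z == 1 then 1 else -1.
exists g; first by move=> x; rewrite /= /g; case: (A3 x) => ->; rewrite ?f0 ?f1 ?fN.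
move=> z; rewrite /= /g; case: ifP => [/eqP ->|z0]; first by rewrite f0.
case: ifP => [/eqP ->|z1]; first by rewrite f1.
rewrite fN; apply/val_inj; case: z z0 z1 => -[|[|[|m]]] //=.
Qed.

Lemma ring_isomorphic_F3_cases (A : comNzRingType) :
  ring_isomorphic A 'F_3 ->
  3%:R = 0 :> A /\ (forall x : A, [\/ x = 0, x = 1 | x = -1]).
Proof.
case=> f fbij; have finj := bij_inj fbij; split.
  by apply: finj; rewrite rmorph_nat rmorph0; apply/val_inj.
move=> x; have : [\/ f x = 0, f x = 1 | f x = -1].
  by case: (f x) => -[|[|[|m]]] // im;
    [constructor 1|constructor 2|constructor 3]; apply/val_inj.
case=> h; [constructor 1|constructor 2|constructor 3]; apply: finj; rewrite h.
- by rewrite rmorph0.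
- by rewrite rmorph1.
- by rewrite rmorphN1.
Qed.

(** * Powers modulo a prime, and reduction modulo the nilradical *)

Lemma exprD_prime_mod (A : comNzRingType) (p : nat) (x y : A) :
  prime p -> exists z, (x + y) ^+ p = x ^+ p + y ^+ p + p%:R * z.
Proof.
move=> pp; have p0 := prime_gt0 pp.
rewrite exprDn big_ord_recr /= subnn binn mulr1n mul1r.
case: p pp p0 => [//|p] pp _.
rewrite big_ord_recl /= subn0 bin0 mulr1n mulr1.
(* The inner binomial coefficients are divisible by the prime [p.+1]; their quotients make up the
   witness. *)
exists (\sum_(i < p) (x ^+ (p.+1 - bump 0 i) * y ^+ bump 0 i) *+
          ('C(p.+1, bump 0 i) %/ p.+1)).
rewrite mulr_sumr [in RHS]addrAC; congr (_ + _ + _).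
apply: eq_bigr => i _; rewrite mulr_natl -mulrnA divnK //.
by apply: prime_dvd_bin; rewrite //= /bump /= add1n ltnS ltn_ord.
Qed.

Lemma expr_sub1_prime_mod (A : comNzRingType) (p m : nat) (x : A) :
  prime p -> exists z, (x - 1) ^+ (p ^ m) = x ^+ (p ^ m) - 1 + p%:R * z.
Proof.
move=> pp; elim: m => [|m [z IH]]; first by exists 0; rewrite mulr0 addr0 !expr1.
rewrite expnSr !exprM IH.
set y := x ^+ (p ^ m).
have [a Ha] := exprD_prime_mod (y - 1) (p%:R * z) pp.
(* Expanding [((y - 1) + 1)^p] instead of [(y - 1)^p] avoids the sign [(-1)^p], so that [p = 2] is
   not a separate case. *)
have [b Hb] := exprD_prime_mod (y - 1) 1 pp.
exists (a - b + p%:R ^+ p.-1 * z ^+ p); rewrite Ha.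
move: Hb; rewrite subrK expr1n => ->; rewrite exprMn.
have -> : p%:R ^+ p = p%:R * p%:R ^+ p.-1 :> A by rewrite -exprS prednK ?prime_gt0.
ring.
Qed.

Lemma nilradical_nonunit (A : comNzRingType) (a b : A) :
  a \in nilradical A -> a * b <> 1.
Proof. by move=> aN ab; have := nilradical_mulr b aN; rewrite ab idealr1. Qed.

Lemma nilradical_kernel (A B : comNzRingType) (f : {rmorphism A -> B}) (a c : A) :
  (forall x, f x = 0 <-> exists y, x = y * c) -> f a \in nilradical B ->
  exists k y, a ^+ k = y * c.
Proof.
by move=> fker /nilradicalP[k fak]; exists k; apply/fker; rewrite rmorphXn.
Qed.

Lemma unit_mul_eq0 (A : comNzRingType) (y a b : A) :
  y * a = 1 -> a * b = 0 -> b = 0.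
Proof. by move=> ya ab; rewrite -[b]mul1r -ya -mulrA ab mulr0. Qed.

(** [2 = 2^2 - 2], and [x^2 - x] is nilpotent for every [x = n + e]. *)
Lemma nil_clean_nil2 (A : comNzRingType) : nil_clean A -> 2%:R \in nilradical A.
Proof.
move=> /(_ 2%:R)[n [e [/nilradicalP nN ee ne]]].
have -> : 2%:R = 2%:R * 2%:R - 2%:R :> A by ring.
rewrite {1 2 3}ne.
have -> : (n + e) * (n + e) - (n + e) = n * (n + 2%:R * e - 1) + (e * e - e) by ring.
by rewrite ee subrr addr0 nilradical_mulr.
Qed.

Lemma nil_clean_quot_boolean (A : comNzRingType) :
  nil_clean A -> boolean_ring {ideal_quot (nilradical A)}.
Proof.
move=> Anc b; have [x <-] := ideal_pi_surj b.
apply/eqP; rewrite -subr_eq0 -rmorphXn -rmorphB; apply/eqP/ideal_pi_eq0.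
have [n [e [/nilradicalP nN ee ->]]] := Anc x.
have -> : (n + e) ^+ 2 - (n + e) = n * (n + 2%:R * e - 1) + (e * e - e) by ring.
by rewrite ee subrr addr0 nilradical_mulr.
Qed.

(* An idempotent [e] makes [2e - 1] a unit, hence congruent to [1] or [-1]
   modulo the nilradical. *)
Lemma weakly_nil_clean_quot_F3 (A : comNzRingType) :
  weakly_nil_clean A -> 3%:R \in nilradical A ->
  ring_isomorphic {ideal_quot (nilradical A)} 'F_3.
Proof.
move=> Awnc nil3; have [w w2] := nil3_half nil3.
apply: ring_isomorphic_F3.
  by rewrite -(rmorph_nat (ideal_pi (nilradical A))); apply/ideal_pi_eq0.
move=> b; have [x <-] := ideal_pi_surj b.
have [n [e [/nilradicalP /ideal_pi_eq0 n0 ee xne]]] := Awnc x.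
have [e0|e1] : ideal_pi (nilradical A) e = 0 \/ ideal_pi (nilradical A) e = 1.
- have uu : (2%:R * e - 1) * (2%:R * e - 1) = 1.
    have -> : (2%:R * e - 1) * (2%:R * e - 1) = 4%:R * (e * e - e) + 1 by ring.
    by rewrite ee subrr mulr0 add0r.
  case: (weakly_nil_clean_unit Awnc uu) => h.
    right; apply/eqP; rewrite -subr_eq0 -(rmorph1 (ideal_pi _)) -rmorphB.
    apply/eqP/ideal_pi_eq0.
    have -> : e - 1 = (2%:R * e - 1 - 1) * w + (1 - 2%:R * w) * (e - 1) by ring.
    by rewrite w2 subrr mul0r addr0 nilradical_mulr.
  left; apply/ideal_pi_eq0.
  have -> : e = (2%:R * e - 1 + 1) * w + (1 - 2%:R * w) * e by ring.
  by rewrite w2 subrr mul0r addr0 nilradical_mulr.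
- constructor 1; case: xne => ->; rewrite ?rmorphB ?rmorphD /= n0 e0 ?oppr0 ?addr0 ?subr0 //.
- case: xne => ->; [constructor 2 | constructor 3].
    by rewrite rmorphD /= n0 e1 add0r.
  by rewrite rmorphB /= n0 e1 sub0r.
Qed.

End RingLemmas.

(** * Orders and powers of group elements *)

Section GroupLemmas.
Local Open Scope group_scope.

(** Take the least positive exponent that kills [g]; a nonzero remainder of [N] modulo it would be a
    smaller one. *)
Lemma has_order_dvdn (G : groupType) (g : G) (N : nat) :
  (0 < N)%N -> g ^+ N = 1 -> exists2 n, has_order g n & (n %| N)%N.
Proof.
move=> N0 gN.
have [|n /andP[n0 /eqP gn] nmin] := @ex_minnP (fun n => (0 < n)%N && (g ^+ n == 1)).
  by exists N; rewrite N0 gN eqxx.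
exists n; first by split=> // m m0 gm; apply: nmin; rewrite m0 gm eqxx.
case: (posnP (N %% n)) => [/eqP //|r0].
have gr : g ^+ (N %% n) = 1.
  by move: gN; rewrite {1}(divn_eq N n) expgnDr mulnC expgnA gn expg1n mul1g.
have := nmin (N %% n)%N; rewrite r0 gr eqxx => /(_ isT).
by rewrite leqNgt ltn_mod n0.
Qed.

Lemma in_torsion_componentE (p : nat) (G : groupType) (g : G) :
  prime p -> (exists m, g ^+ (p ^ m) = 1) -> in_torsion_component p g.
Proof.
move=> pp [m gm].
have [|n gn] := has_order_dvdn _ gm; first by rewrite expn_gt0 prime_gt0.
by case/(dvdn_pfactor _ _ pp) => k _ nE; exists k; rewrite -nE.
Qed.

Lemma in_torsion_component_expg (p : nat) (G : groupType) (g : G) :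
  in_torsion_component p g -> exists m, g ^+ (p ^ m) = 1.
Proof. by case=> k [_ ? _]; exists k. Qed.

Lemma expg_coprime_eq1 (G : groupType) (g : G) (m n : nat) :
  coprime m n -> g ^+ m = 1 -> g ^+ n = 1 -> g = 1.
Proof.
move=> cmn gm gn; case: (posnP m) => [m0|m0].
  by move: cmn gn; rewrite m0 /coprime gcd0n => /eqP ->; rewrite expg1.
have [u v uv _] := egcdnP n m0.
move/eqP: cmn uv => -> uv.
have := congr1 (fun k => g ^+ k) uv.
by rewrite mulnC expgnA gm expg1n expgnDr mulnC expgnA gn expg1n mul1g expg1.
Qed.

Lemma expg_eq_finite_order (G : groupType) (g : G) (a b : nat) :
  a != b -> g ^+ a = g ^+ b -> exists2 n, (0 < n)%N & g ^+ n = 1.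
Proof.
wlog ab : a b / (a < b)%N.
  move=> H ne gab; case: (ltngtP a b) => ab;
    [exact: H gab | | by rewrite ab eqxx in ne].
  by apply: (H b a) => //; rewrite eq_sym.
move=> _ gab; exists (b - a)%N; first by rewrite subn_gt0.
by rewrite (expgnFr _ (ltnW ab)) gab mulgV.
Qed.

Lemma involution_expg (G : groupType) (t : G) (n : nat) :
  t * t = 1 -> t ^+ n = 1 \/ t ^+ n = t.
Proof.
move=> tt; elim: n => [|n [IH|IH]]; first by left.
  by right; rewrite expgS IH mulg1.
by left; rewrite expgS IH.
Qed.

End GroupLemmas.

(** * Monomials, partial coefficient sums and the augmentation *)

Section GroupRing.
Local Open Scope ring_scope.
Context (R : comNzRingType) (G : abGroupType).
Implicit Types (g h : G) (r s : R) (x y c : group_ring R G).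

(** Retypes the monomial in the alias [group_ring], so that products are convolutions. *)
Definition gr_mono r g : group_ring R G := << r *g g >>.

Lemma gr_monoM r s g h : gr_mono r g * gr_mono s h = gr_mono (r * s) (g * h)%g.
Proof. exact: gr_mulUU. Qed.

Lemma gr_mono_eq0 r g : (gr_mono r g == 0) = (r == 0).
Proof. exact: monalgU_eq0. Qed.

Lemma gr_ind (P : group_ring R G -> Prop) :
  P 0 -> (forall r g, P (gr_mono r g)) -> (forall x y, P x -> P y -> P (x + y)) ->
  forall x, P x.
Proof.
move=> P0 PU PD x; rewrite [x]monalgE.
by apply: (big_ind P) => // g _; apply: PU.
Qed.

Definition gr_scalar r : group_ring R G := gr_mono r 1%g.

Lemma gr_scalar_is_zmod_morphism : zmod_morphism gr_scalar.
Proof. by move=> r s; rewrite /gr_scalar /gr_mono monalgUB. Qed.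

Lemma gr_scalar_is_monoid_morphism : monoid_morphism gr_scalar.
Proof. by split=> // r s; rewrite /gr_scalar gr_monoM mulg1. Qed.

HB.instance Definition _ :=
  GRing.isZmodMorphism.Build R (group_ring R G) gr_scalar gr_scalar_is_zmod_morphism.
HB.instance Definition _ :=
  GRing.isMonoidMorphism.Build R (group_ring R G) gr_scalar
    gr_scalar_is_monoid_morphism.

Definition gr_elt g : group_ring R G := gr_mono 1 g.

Lemma gr_elt1 : gr_elt 1%g = 1. Proof. by []. Qed.

Lemma gr_eltM g h : gr_elt (g * h)%g = gr_elt g * gr_elt h.
Proof. by rewrite /gr_elt gr_monoM mulr1. Qed.

Lemma gr_eltX g n : gr_elt (g ^+ n)%g = gr_elt g ^+ n.
Proof. by elim: n => [|n IH]; rewrite ?expg0 // expgS exprS gr_eltM IH. Qed.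

Lemma gr_monoE r g : gr_mono r g = gr_scalar r * gr_elt g.
Proof. by rewrite /gr_scalar gr_monoM mulr1 mul1g. Qed.

(** The linear functional adding up the coefficients at the elements of [P]. It is used for the
    whole group (augmentation), for the identity alone, and for a cyclic subgroup. *)
Definition mcoeff_sum (P : pred G) x : R := mmap idfun (fun g => (P g)%:R) x.

Lemma mcoeff_sum_is_zmod_morphism P : zmod_morphism (mcoeff_sum P).
Proof. exact: mmap_is_additive. Qed.

HB.instance Definition _ P :=
  GRing.isZmodMorphism.Build (group_ring R G) R (mcoeff_sum P)
    (mcoeff_sum_is_zmod_morphism P).

Lemma mcoeff_sum_mono P r g : mcoeff_sum P (gr_mono r g) = r * (P g)%:R.
Proof. by rewrite /mcoeff_sum mmapU. Qed.

Lemma mcoeff_sum_elt P g : mcoeff_sum P (gr_elt g) = (P g)%:R.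
Proof. by rewrite mcoeff_sum_mono mul1r. Qed.

Lemma mcoeff_sum1 P : mcoeff_sum P 1 = (P 1%g)%:R.
Proof. by rewrite -gr_elt1 mcoeff_sum_elt. Qed.

Lemma mcoeff_sum_scalar P r x : mcoeff_sum P (gr_scalar r * x) = r * mcoeff_sum P x.
Proof.
elim/gr_ind: x => [|s g|x y IHx IHy]; first by rewrite mulr0 raddf0 mulr0.
  by rewrite gr_monoM !mcoeff_sum_mono mul1g mulrA.
by rewrite mulrDr !raddfD /= IHx IHy mulrDr.
Qed.

Lemma mcoeff_sum_nat P n x : mcoeff_sum P (n%:R * x) = n%:R * mcoeff_sum P x.
Proof. by rewrite -(rmorph_nat gr_scalar) mcoeff_sum_scalar. Qed.

(** Translation by [h] preserves [P], so the contributions of [g * h] and [g] cancel. *)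
Lemma mcoeff_sum_coset (P : pred G) h x :
  (forall g, P (g * h)%g = P g) -> mcoeff_sum P (x * (gr_elt h - 1)) = 0.
Proof.
move=> Ph; elim/gr_ind: x => [|s g|x y IHx IHy]; first by rewrite mul0r raddf0.
  by rewrite mulrBr mulr1 raddfB /= gr_monoM !mcoeff_sum_mono Ph mulr1 subrr.
by rewrite mulrDl raddfD /= IHx IHy addr0.
Qed.

Definition aug : group_ring R G -> R := mcoeff_sum predT.

Lemma aug_is_zmod_morphism : zmod_morphism aug.
Proof. exact: raddfB. Qed.

Lemma aug_mono r g : aug (gr_mono r g) = r.
Proof. by rewrite /aug mcoeff_sum_mono mulr1. Qed.

Lemma aug_elt g : aug (gr_elt g) = 1.
Proof. exact: aug_mono. Qed.

Lemma aug_scalar r : aug (gr_scalar r) = r.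
Proof. exact: aug_mono. Qed.

HB.instance Definition _ :=
  GRing.isZmodMorphism.Build (group_ring R G) R aug aug_is_zmod_morphism.

Lemma aug_is_monoid_morphism : monoid_morphism aug.
Proof.
split=> [|x y]; first by rewrite /aug mcoeff_sum1.
elim/gr_ind: x => [|s g|x x' IHx IHx']; first by rewrite mul0r raddf0 mul0r.
  rewrite aug_mono gr_monoE -mulrA [LHS]mcoeff_sum_scalar; congr (_ * _).
  (* It remains that [g] and 1 act alike under the augmentation: [(g - 1) y] has coefficient sum
     0. *)
  apply/eqP; rewrite -subr_eq0 -raddfB -{2}[y]mul1r -mulrBl mulrC; apply/eqP.
  exact: mcoeff_sum_coset.
by rewrite mulrDl !raddfD /= IHx IHx' mulrDl.
Qed.

HB.instance Definition _ :=
  GRing.isMonoidMorphism.Build (group_ring R G) R aug aug_is_monoid_morphism.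

End GroupRing.

(** * Necessity: what weak nil-neatness of the group ring imposes *)

Section WeaklyNilNeatGroupRing.
Local Open Scope ring_scope.
Context (R : comNzRingType) (G : abGroupType).
Implicit Types (g h t : G) (r s : R) (x y c : group_ring R G).
Local Notation elt := (@gr_elt R G).

Lemma mcoeff_sum_at1 g : g <> 1%g -> mcoeff_sum (pred1 1%g) (elt g) = 0.
Proof. by move=> /eqP g1; rewrite mcoeff_sum_elt /= (negPf g1). Qed.

Lemma gr_elt_sub1_neq0 g : g <> 1%g -> elt g - 1 != 0.
Proof.
move=> g1; apply/eqP => /(congr1 (mcoeff_sum (pred1 1%g))) /eqP.
rewrite raddfB raddf0 /= mcoeff_sum_at1 //.
by rewrite mcoeff_sum1 /= eqxx sub0r oppr_eq0 oner_eq0.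
Qed.

Lemma gr_elt_sub1_nonunit g y : y * (elt g - 1) <> 1.
Proof.
move/(congr1 (@aug R G))/eqP; rewrite rmorphM rmorphB !rmorph1 /= aug_elt subrr mulr0.
by rewrite eq_sym oner_eq0.
Qed.

(** Modulo [p], [(g - 1)^(p^k)] is [g^(p^k) - 1], whose sum over [P] is -1 if [g^(p^k)] lies outside
    [P]. As the sums of multiples of [c] lie in [pR], [p] would be a unit. *)
Lemma coset_expg_prime (P : pred G) (p k : nat) c y g :
  prime p -> (forall r, p%:R * r <> 1) -> P 1%g ->
  (forall x, exists r, mcoeff_sum P (x * c) = p%:R * r) ->
  (elt g - 1) ^+ k = y * c -> exists m, P (g ^+ (p ^ m))%g.
Proof.
move=> pp pnu P1 cP gk; exists k; apply/negP => /negP/negPf Pg.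
have [z gz] := expr_sub1_prime_mod k (elt g) pp.
(* The exponent may grow from [k] to [p^k] without leaving the ideal of [c]. *)
have kp : (k <= p ^ k)%N by apply/ltnW/ltn_expl/prime_gt1.
have [r yr] := cP ((elt g - 1) ^+ (p ^ k - k) * y).
have := congr1 (mcoeff_sum P) gz.
rewrite -{1}(subnK kp) exprD gk mulrA yr -gr_eltX raddfD raddfB /=.
rewrite mcoeff_sum_elt Pg mcoeff_sum1 P1 mcoeff_sum_nat sub0r /= => pr.
by apply: (pnu (mcoeff_sum P z - r)); rewrite mulrBr pr; ring.
Qed.

(** The case where [c] is [p] and [P] is the identity alone; [z = 0] covers nilpotent [g - 1]. *)
Lemma expg_prime_mod (p k : nat) z g :
  prime p -> (forall r, p%:R * r <> 1) ->
  (elt g - 1) ^+ k = p%:R * z -> exists m, (g ^+ (p ^ m))%g = 1%g.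
Proof.
move=> pp pnu; rewrite mulrC => gk.
have [||m /eqP gm] := @coset_expg_prime (pred1 1%g) p k p%:R z g pp pnu _ _ gk.
- exact: eqxx.
- by move=> x; exists (mcoeff_sum (pred1 1%g) x); rewrite mulrC mcoeff_sum_nat.
- by exists m.
Qed.

(* Membership of [g] in the subgroup generated by [h], stated without inverses
   so that its invariance under translation by [h] needs no sign analysis. *)
Definition cyc h g := exists i j : nat, (g * h ^+ i)%g = (h ^+ j)%g.

Lemma cyc_mulr h g : cyc h (g * h)%g <-> cyc h g.
Proof.
split=> -[i [j e]]; first by exists i.+1, j; rewrite expgS mulgA.
by exists i, j.+1; rewrite expgSr -e -!mulgA -expgSr expgS.
Qed.

Lemma cyc_mcoeff_sum h x :
  mcoeff_sum (fun g => `[< cyc h g >]) (x * (elt h - 1)) = 0.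
Proof. by apply: mcoeff_sum_coset => g; apply: asbool_equiv_eq; apply: cyc_mulr. Qed.

Lemma cyc1 h : cyc h 1%g. Proof. by exists 0%N, 0%N; rewrite mulg1. Qed.

Lemma torsion_of_radical (p : nat) h :
  prime p -> p%:R \in nilradical R ->
  (forall c, c != 0 -> (forall y, y * c <> 1) ->
     exists k y, (elt h - 1) ^+ k = y * c) ->
  exists m, (h ^+ (p ^ m))%g = 1%g.
Proof.
move=> pp pN hrad; have pnu r : p%:R * r <> 1 by apply: nilradical_nonunit.
have [->|/eqP h1] := eqVneq h 1%g; first by exists 0%N; rewrite expg1n.
have [N N0 hN] : exists2 N, (0 < N)%N & (h ^+ N)%g = 1%g.
  have [hp|/eqP hp] := eqVneq (h ^+ p.+1)%g 1%g; first by exists p.+1.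
  have [k [y hk]] := hrad _ (gr_elt_sub1_neq0 hp) (gr_elt_sub1_nonunit (g := _)).
  have [||m /asboolP[i [j]]] :=
    @coset_expg_prime (fun g => `[< cyc (h ^+ p.+1)%g g >]) p k _ y h pp pnu _ _ hk.
  - exact/asboolP/cyc1.
  - by move=> x; exists 0; rewrite cyc_mcoeff_sum mulr0.
  rewrite -!expgnA -expgnDr => /expg_eq_finite_order; apply.
  (* The exponent [p + 1] was chosen coprime to [p]: equality of the two exponents would make it
     divide [p^m]. *)
  apply/eqP => e; have : (p.+1 %| p ^ m)%N.
    by rewrite -(dvdn_addl (p ^ m) (dvdn_mulr i (dvdnn p.+1))) e dvdn_mulr.
  move/gcdn_idPl => pm; have := coprimeXr m (coprimeSn p).
  by rewrite /coprime pm eqSS => /eqP p0; move: pp; rewrite p0.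
have [n [n0 hn nmin] _] := has_order_dvdn N0 hN.
(* The norm of [h]. It is nonzero because [n] is the exact order, which makes its coefficient at the
   identity 1, and it is no unit because it annihilates [h - 1]. *)
pose c := \sum_(i < n) elt h ^+ i.
have ch : (elt h - 1) * c = 0.
  by rewrite /c -subrX1 -gr_eltX hn subrr.
have c1 : mcoeff_sum (pred1 1%g) c = 1.
  case: n n0 hn nmin @c ch => // n _ hn nmin c _.
  rewrite /c big_ord_recl expr0 raddfD raddf_sum /= mcoeff_sum1 /= eqxx.
  rewrite big1 ?addr0 // => i _.
  rewrite -gr_eltX mcoeff_sum_at1 // => hi.
  by have := nmin (bump 0 i) isT hi; rewrite /bump /= add1n leqNgt !ltnS ltn_ord.
have [|y yc|k [y hk]] := hrad c.
- by apply: contra_eq_neq c1 => ->; rewrite raddf0 eq_sym oner_eq0.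
- have /eqP := gr_elt_sub1_neq0 h1; apply.
  by have := mulrCA (elt h - 1) y c; rewrite ch mulr0 yc mulr1.
(* One more factor [h - 1] kills [y * c], so [h - 1] is nilpotent. *)
- apply: (@expg_prime_mod p k.+1 0 h pp pnu).
  by rewrite exprS hk mulrCA ch !mulr0.
Qed.

Lemma weakly_nil_neat_elt c :
  weakly_nil_neat (group_ring R G) -> c != 0 -> (forall y, y * c <> 1) ->
  exists (B : comNzRingType) (f : {rmorphism group_ring R G -> B}),
    (forall g, f (elt g) - 1 \in nilradical B \/ f (elt g) + 1 \in nilradical B) /\
    (forall x, f x = 0 <-> exists y, x = y * c).
Proof.
move=> neat c0 cnu; have [B [f [Bwnc fker]]] := weakly_nil_neat_principal neat c0 cnu.
exists B, f; split=> // g; apply: (weakly_nil_clean_unit (v := f (elt g^-1%g))) => //.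
by rewrite -rmorphM -gr_eltM mulgV gr_elt1 rmorph1.
Qed.

(** In [g^2 - 1 = (g - 1)(g + 1)] one factor is nilpotent modulo [c]. *)
Lemma weakly_nil_neat_sqr c g :
  weakly_nil_neat (group_ring R G) -> c != 0 -> (forall y, y * c <> 1) ->
  exists k y, (elt (g ^+ 2)%g - 1) ^+ k = y * c.
Proof.
move=> neat c0 cnu; have [B [f [felt fker]]] := weakly_nil_neat_elt neat c0 cnu.
apply: (nilradical_kernel fker).
rewrite gr_eltX rmorphB rmorph1 rmorphXn subr_sqr_1.
by case: (felt g) => fg; [|rewrite mulrC]; apply: nilradical_mulr.
Qed.

(** With 2 nilpotent modulo [c], the alternatives [g - 1] and [g + 1] nilpotent coincide. *)
Lemma weakly_nil_neat_nil2 c g (j : nat) y :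
  weakly_nil_neat (group_ring R G) -> c != 0 -> (forall y, y * c <> 1) ->
  2%:R ^+ j = y * c -> exists k y, (elt g - 1) ^+ k = y * c.
Proof.
move=> neat c0 cnu jc; have [B [f [felt fker]]] := weakly_nil_neat_elt neat c0 cnu.
apply: (nilradical_kernel fker); rewrite rmorphB rmorph1.
have nil2 : 2%:R \in nilradical B.
  apply/nilradicalP; exists j; rewrite -(rmorph_nat f) -rmorphXn.
  by apply/fker; exists y.
case: (felt g) => // fg.
have -> : f (elt g) - 1 = f (elt g) + 1 - 2%:R by ring.
exact: rpredB.
Qed.

Lemma nilradical_nat_scalar n :
  n%:R \in nilradical R -> n%:R \in nilradical (group_ring R G).
Proof. by move=> nN; rewrite -(rmorph_nat (gr_scalar G)) nilradical_morph. Qed.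

Hypothesis ntG : ~ trivial_group G.

Lemma nontrivial_elt : exists g : G, g <> 1%g.
Proof. by apply: contra_notP ntG => H g; apply: contra_notP H => g1; exists g. Qed.

Lemma aug_surj r : exists x : group_ring R G, aug x = r.
Proof. by exists (gr_scalar G r); rewrite /= aug_scalar. Qed.

Hypothesis neat : weakly_nil_neat (group_ring R G).

(** The augmentation is onto [R] and kills [g - 1], which is nonzero for [g] other than 1. *)
Lemma coef_ring_weakly_nil_clean : weakly_nil_clean R.
Proof.
have [g g1] := nontrivial_elt.
apply: (weakly_nil_neat_noninjective aug_surj (gr_elt_sub1_neq0 g1)) neat.
by rewrite rmorphB rmorph1 /= aug_elt subrr.
Qed.

(* Otherwise reducing modulo the powers of 2 and of 3 makes [G] both a
   2-group and a 3-group. *)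
Lemma nil2_or_nil3 : 2%:R \in nilradical R \/ 3%:R \in nilradical R.
Proof.
case: (boolP (2%:R \in nilradical R)) => n2; [by left | right].
apply/negPn/negP => n3; apply: ntG => g.
have /nilradicalP[[|k]] := weakly_nil_clean_nil6 coef_ring_weakly_nil_clean.
  by move/eqP; rewrite expr0 oner_eq0.
rewrite -[6%N]/(2 * 3)%N natrM exprMn => k6.
have n2X n : 2%:R ^+ n <> 0 :> R.
  by move=> e; move/negP: n2; apply; apply/nilradicalP; exists n.
have n3X n : 3%:R ^+ n <> 0 :> R.
  by move=> e; move/negP: n3; apply; apply/nilradicalP; exists n.
have augX n m : aug (n%:R ^+ m : group_ring R G) = n%:R ^+ m.
  by rewrite rmorphXn rmorph_nat.
have gX n m x : (x * n%:R ^+ m.+1 : group_ring R G) = n%:R * (x * n%:R ^+ m).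
  by rewrite exprS mulrCA.
(* The ideal of [2^(k+1)] is nonzero as 2 is not nilpotent, and proper since otherwise [3^(k+1)]
   would be 0. *)
have [m2 gm2] : exists m, (g ^+ (2 ^ m))%g = 1%g.
  have [|||j] := @weakly_nil_neat_nil2 (2%:R ^+ k.+1) g k.+1 1 neat.
  - by apply/eqP => /(congr1 (@aug R G)); rewrite /= augX rmorph0 => /n2X.
  - move=> y /(congr1 (@aug R G)); rewrite rmorphM /= augX rmorph1 => e.
    exact: n3X k.+1 (unit_mul_eq0 e k6).
  - by rewrite mul1r.
  - case=> y; rewrite gX; apply: expg_prime_mod => // r e.
    by apply: n3X k.+1 (unit_mul_eq0 (y := r ^+ k.+1) _ k6);
      rewrite -exprMn mulrC e expr1n.
have [m3 gm3] : exists m, (g ^+ (3 ^ m))%g = 1%g.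
  have [||B [f [felt fker]]] := @weakly_nil_neat_elt (3%:R ^+ k.+1) neat.
  - by apply/eqP => /(congr1 (@aug R G)); rewrite /= augX rmorph0 => /n3X.
  - move=> y /(congr1 (@aug R G)); rewrite rmorphM /= augX rmorph1 => e.
    by apply: n2X k.+1 (unit_mul_eq0 e _); rewrite mulrC.
  have nu3 r : 3%:R * r <> 1.
    move=> e; apply: n2X k.+1 (unit_mul_eq0 (a := 3%:R ^+ k.+1) (y := r ^+ k.+1) _ _).
      by rewrite -exprMn mulrC e expr1n.
    by rewrite mulrC.
  case: (felt g) => fg.
    have [|j [y]] := nilradical_kernel (a := elt g - 1) fker.
      by rewrite rmorphB rmorph1.
    by rewrite gX; apply: expg_prime_mod.
  (* This sign is impossible: the augmentation makes [2^j] a multiple of [3^(k+1)], whence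
     [2^(j+k+1) = 0]. *)
  have [|j [y]] := nilradical_kernel (a := elt g + 1) fker.
    by rewrite rmorphD rmorph1.
  move/(congr1 (@aug R G)).
  rewrite rmorphM /= augX rmorphXn rmorphD rmorph1 /= aug_elt => e.
  case: (n2X (j + k.+1)%N); rewrite exprD -[2%:R]/(1 + 1) e.
  by rewrite -mulrA [_ ^+ _ * _]mulrC k6 mulr0.
by apply: expg_coprime_eq1 gm2 gm3; rewrite coprimeXl // coprimeXr.
Qed.

Lemma weakly_nil_neat_case2 : 2%:R \in nilradical R -> neat_case2 R G.
Proof.
move=> nil2; split=> //.
  move=> g; apply: in_torsion_componentE => //.
  apply: torsion_of_radical => // c c0 cnu.
  (* A power of 2 is 0, hence lies in every ideal, with cofactor 0. *)
  have /nilradicalP[j j2] := nilradical_nat_scalar nil2.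
  by apply: (@weakly_nil_neat_nil2 c g j 0) => //; rewrite mul0r.
exact: weakly_nil_clean_nil_clean nil2 coef_ring_weakly_nil_clean.
Qed.

Hypothesis nil3 : 3%:R \in nilradical R.

Lemma sqr_torsion g : exists m, ((g ^+ 2) ^+ (3 ^ m))%g = 1%g.
Proof.
by apply: torsion_of_radical => // c c0 cnu; apply: weakly_nil_neat_sqr.
Qed.

(** * An involution in [G] when 3 is nilpotent in [R] *)

Section Involution.
Context (t : G) (t1 : t <> 1%g) (t2 : (t ^+ 2)%g = 1%g).

(** Since 2 is invertible in the quotient, a square root of 1 that is 1 or -1 up to a nilpotent
    equals it; so the ideal itself, not just its radical, is reached. *)
Lemma involution_principal c : c != 0 -> (forall y, y * c <> 1) ->
  exists y, elt t - 1 = y * c \/ elt t + 1 = y * c.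
Proof.
move=> c0 cnu; have [B [f [felt fker]]] := weakly_nil_neat_elt neat c0 cnu.
have [w w2] : exists w : B, 2%:R * w = 1.
  by apply: nil3_half; rewrite -(rmorph_nat f) nilradical_morph // nilradical_nat_scalar.
have ft : f (elt t) * f (elt t) = 1.
  by rewrite -rmorphM -expr2 -gr_eltX t2 gr_elt1 rmorph1.
case: (felt t) => ft1.
  have /fker[y ey] : f (elt t - 1) = 0.
    by rewrite rmorphB rmorph1 (square_root_of_one w2 ft ft1) subrr.
  by exists y; left.
have /fker[y ey] : f (elt t + 1) = 0.
  rewrite rmorphD rmorph1; apply/eqP; rewrite addr_eq0 -eqr_oppLR; apply/eqP.
  by apply: (square_root_of_one w2); rewrite ?mulrNN // -opprD rpredN.
by exists y; right.
Qed.

(** If [r] were not a unit, its ideal would contain [t - 1] or [t + 1], whose coefficient -1 or 1 at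
    the identity would be a multiple of [r]. *)
Lemma involution_field r : r != 0 -> exists s, s * r = 1.
Proof.
move=> r0; apply: contrapT => rnu.
have [||y] := @involution_principal (gr_scalar G r).
- by rewrite gr_mono_eq0.
- move=> y /(congr1 (@aug R G)); rewrite rmorphM rmorph1 /= aug_scalar => e.
  by apply: rnu; exists (aug y).
have cr : mcoeff_sum (pred1 1%g) (y * gr_scalar G r) = mcoeff_sum (pred1 1%g) y * r.
  by rewrite mulrC mcoeff_sum_scalar mulrC.
case=> /(congr1 (mcoeff_sum (pred1 1%g))); rewrite cr raddfD /= mcoeff_sum_at1 //.
  rewrite raddfN /= mcoeff_sum1 /= eqxx add0r => e; apply: rnu.
  by exists (- mcoeff_sum (pred1 1%g) y); rewrite mulNr -e opprK.
by rewrite mcoeff_sum1 /= eqxx add0r => e; apply: rnu;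
   exists (mcoeff_sum (pred1 1%g) y).
Qed.

Lemma involution_F3 : ring_isomorphic R 'F_3.
Proof.
have nil0 r : r \in nilradical R -> r = 0.
  move=> rN; apply/eqP; apply: contraPT rN => /involution_field[s sr] rN.
  by apply: (nilradical_nonunit (b := s) rN); rewrite mulrC.
have mul0 r s : r * s = 0 -> r = 0 \/ s = 0.
  have [->|/involution_field[r' r'r]] := eqVneq r 0; first by left.
  by move=> rs; right; rewrite -[s]mul1r -r'r -mulrA rs mulr0.
apply: ring_isomorphic_F3; first exact: nil0.
move=> r; case: (weakly_nil_clean_split r coef_ring_weakly_nil_clean) => /nil0/mul0[].
- by move=> ->; constructor 1.
- by move=> /eqP; rewrite subr_eq0 => /eqP ->; constructor 2.
- by move=> ->; constructor 1.
- by move=> /eqP; rewrite addr_eq0 => /eqP ->; constructor 3.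
Qed.

(** The sum over the subgroup of [g] vanishes on multiples of [g - 1], one of which is [t - 1] or
    [t + 1]; for [t] outside the subgroup that sum would be -1 or 1. *)
Lemma involution_cyc g : g <> 1%g -> cyc g t.
Proof.
move=> g1; apply: contrapT => ngt.
have [y] := involution_principal (gr_elt_sub1_neq0 g1) (gr_elt_sub1_nonunit (g := g)).
have ct : mcoeff_sum (fun h => `[< cyc g h >]) (elt t) = 0.
  by rewrite mcoeff_sum_elt asboolF.
case=> /(congr1 (mcoeff_sum (fun h => `[< cyc g h >])));
  rewrite cyc_mcoeff_sum ?raddfB ?raddfD /= ct mcoeff_sum1 asboolT;
  [|exact: cyc1|..|exact: cyc1].
- by rewrite sub0r => /eqP; rewrite oppr_eq0 oner_eq0.
- by rewrite add0r => /eqP; rewrite oner_eq0.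
Qed.

(** If [g^2] is not 1, then [t] lies in the subgroup it generates, so a power of 3 kills [t],
    against [t^2 = 1]. Otherwise [t] lies in the subgroup [{1, g}]. *)
Lemma involution_unique g : g = 1%g \/ g = t.
Proof.
have [m gm] := sqr_torsion g.
have [g2|/eqP g2] := eqVneq (g ^+ 2)%g 1%g; last first.
  case: t1; have [i [j e]] := involution_cyc g2.
  have := congr1 (fun z => z ^+ (3 ^ m))%g e.
  rewrite expgMn; last exact: abelian_mulgC.
  rewrite (expgnAC _ i) (expgnAC _ j) gm !expg1n mulg1 => tm.
  by apply: expg_coprime_eq1 t2 tm; rewrite coprimeXr.
have [->|/eqP g1] := eqVneq g 1%g; [by left | right].
have gg : (g * g)%g = 1%g by rewrite -expg2.
have [i [j]] := involution_cyc g1.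
case: (involution_expg i gg) => ->; case: (involution_expg j gg) => ->; rewrite ?mulg1 //.
- by move=> tg; rewrite -[t]mulg1 -gg mulgA tg mul1g.
- by move=> tg; case: t1; rewrite -[t]mulg1 -gg mulgA tg.
Qed.

Lemma involution_case4 : neat_case4 R G.
Proof.
split; last exact: involution_F3.
exists t; split.
  by split=> // -[|[|m]] // _ tm; case: t1; rewrite -tm expg1.
move=> h; case: (involution_unique h) => ->; first by exists 0%N; left.
by exists 1%N; left; rewrite expg1.
Qed.

End Involution.

Lemma weakly_nil_neat_case34 : neat_case3 R G \/ neat_case4 R G.
Proof.
case: (pselect (exists2 t : G, t <> 1%g & (t ^+ 2)%g = 1%g)) => [[t t1 t2]|no_inv].
  by right; apply: involution_case4 t1 t2.
left; split=> //; last exact: coef_ring_weakly_nil_clean.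
move=> g; apply: in_torsion_componentE => //.
(* [g^(3^m)] squares to 1, so without involutions it is 1. *)
have [m gm] := sqr_torsion g; exists m; apply: contrapT => gm1.
by case: no_inv; exists (g ^+ (3 ^ m))%g => //; rewrite expgnAC.
Qed.

End WeaklyNilNeatGroupRing.

(** * Sufficiency of the four conditions *)

Section Converse.
Local Open Scope ring_scope.
Context (R : comNzRingType) (G : abGroupType).

(** By additivity it suffices to treat [r(g - 1)]; when [g^(p^m) = 1], the power [(g - 1)^(p^m)] is
    a multiple of the nilpotent [p]. *)
Lemma nilradical_aug_ker (p : nat) (x : group_ring R G) :
  prime p -> p%:R \in nilradical R -> torsion_p_group p G ->
  x - gr_scalar G (aug x) \in nilradical (group_ring R G).
Proof.
move=> pp pN Gp; elim/gr_ind: x => [|r g|x y xN yN].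
- by rewrite !rmorph0 subr0 rpred0.
- rewrite aug_mono gr_monoE -{2}[gr_scalar G r]mulr1 -mulrBr; apply: idealMr.
  have [m gm] := in_torsion_component_expg (Gp g).
  have [z gz] := expr_sub1_prime_mod m (gr_elt R g) pp.
  have /nilradicalP[k pk] := nilradical_nat_scalar G pN.
  apply/nilradicalP; exists (p ^ m * k)%N.
  by rewrite exprM gz -gr_eltX gm gr_elt1 subrr add0r exprMn pk mul0r.
- by rewrite (rmorphD (@aug R G)) (rmorphD (gr_scalar G)) opprD addrACA rpredD.
Qed.

Lemma weakly_nil_clean_group_ring (p : nat) :
  prime p -> p%:R \in nilradical R -> torsion_p_group p G ->
  weakly_nil_clean R -> weakly_nil_clean (group_ring R G).
Proof.
move=> pp pN Gp Rwnc x; have xN := nilradical_aug_ker x pp pN Gp.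
have [n [e [/nilradicalP nN ee xne]]] := Rwnc (aug x).
exists (x - gr_scalar G (aug x) + gr_scalar G n), (gr_scalar G e); split.
- by apply/nilradicalP; rewrite rpredD // nilradical_morph.
- by rewrite /idempotent_elt -rmorphM ee.
- by case: xne => ->; [left; rewrite rmorphD | right; rewrite rmorphB]; ring.
Qed.

Lemma weakly_nil_neat_trivial_group :
  trivial_group G -> weakly_nil_neat R -> weakly_nil_neat (group_ring R G).
Proof.
move=> G1; apply: (weakly_nil_neat_image (f := gr_scalar G)) => x.
elim/gr_ind: x => [|r g|_ _ [r <-] [s <-]].
- by exists 0; rewrite rmorph0.
- by exists r; rewrite (G1 g).
- by exists (r + s); rewrite rmorphD.
Qed.

Lemma cyclic_of_order2P :
  cyclic_of_order 2 G ->
  exists t : G, [/\ t <> 1%g, (t * t)%g = 1%g & forall g, g = 1%g \/ g = t].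
Proof.
case=> t [[_ t2 tmin] Gt].
have t1 : t <> 1%g by move=> t1; have := tmin 1%N isT t1.
exists t; split=> // g.
have tV : (t^-1)%g = t by apply: (mulgI t); rewrite mulgV.
have [n [|] ->] := Gt g; first exact: involution_expg.
by rewrite -expVgn tV; apply: involution_expg.
Qed.

(** A nonzero ideal identifies [t] with a scalar, so the quotient is an image of [R], whose elements
    0, 1 and -1 are idempotents up to sign. *)
Lemma weakly_nil_neat_F3_C2 : neat_case4 R G -> weakly_nil_neat (group_ring R G).
Proof.
case=> /cyclic_of_order2P[t [_ tt Gt]] /ring_isomorphic_F3_cases[h3 R3] I [x xI x0].
have et : gr_elt R t * gr_elt R t = 1 by rewrite -gr_eltM tt.
have ab (y : group_ring R G) : exists a b,
    y = gr_scalar G a + gr_scalar G b * gr_elt R t.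
  elim/gr_ind: y => [|r g|_ _ [a [b ->]] [a' [b' ->]]].
  - by exists 0, 0; rewrite rmorph0 mul0r addr0.
  - case: (Gt g) => ->; first by exists r, 0; rewrite rmorph0 mul0r addr0.
    by exists 0, r; rewrite rmorph0 add0r gr_monoE.
  - by exists (a + a'), (b + b'); rewrite !rmorphD; ring.
have [s sI] : exists s, gr_elt R t - gr_scalar G s \in I.
  have [a [b xab]] := ab x.
  have sqr (r : R) : r = 0 \/ r * r = 1.
    by case: (R3 r) => ->; [left | right; rewrite mulr1 | right; rewrite mulrNN mulr1].
  (* As [(t + 1)(a + bt) = (a + b)(t + 1)], a nonzero [a + b] puts [t + 1] in [I]. If [a + b = 0],
     then [x = b(t - 1)] with [b] a unit, and [t - 1] is in [I]. *)
  case: (sqr (a + b)) => abE; last first.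
    exists (-1).
    have <- : gr_scalar G (a + b) * (gr_elt R t + 1) * x =
        gr_elt R t - gr_scalar G (-1).
      rewrite rmorphN1 opprK xab.
      have -> : gr_scalar G (a + b) * (gr_elt R t + 1) *
          (gr_scalar G a + gr_scalar G b * gr_elt R t) =
          gr_scalar G (a + b) * (gr_scalar G a * (gr_elt R t + 1) +
            gr_scalar G b * (gr_elt R t * gr_elt R t + gr_elt R t)) by ring.
      rewrite et [1 + _]addrC -mulrDl -rmorphD mulrA -rmorphM abE rmorph1.
      by rewrite mul1r.
    exact: idealMr.
  exists 1; have bE : a = - b by apply/eqP; rewrite -addr_eq0 abE.
  case: (sqr b) => bb.
    by move/eqP: x0; rewrite xab bE bb oppr0 rmorph0 mul0r addr0.
  have <- : gr_scalar G b * x = gr_elt R t - gr_scalar G 1.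
    rewrite xab bE rmorphN mulrDr mulrN mulrA -rmorphM bb rmorph1.
    by rewrite mul1r addrC.
  exact: idealMr.
apply: (@weakly_nil_clean_image R _ R idfun (ideal_pi I \o gr_scalar G)).
- by move=> c; exists c.
- move=> c; have [y <-] := ideal_pi_surj c; have [a [b ->]] := ab y.
  exists (a + b * s); apply/eqP; rewrite eq_sym -subr_eq0 /= -rmorphB.
  apply/eqP/ideal_pi_eq0.
  have -> : gr_scalar G a + gr_scalar G b * gr_elt R t - gr_scalar G (a + b * s) =
      gr_scalar G b * (gr_elt R t - gr_scalar G s) by rewrite rmorphD rmorphM; ring.
  exact: idealMr.
- by move=> a /= ->; rewrite !rmorph0.
- move=> r; case: (R3 r) => ->.
  + by exists 0, 0; split;
      [exists 1%N | rewrite /idempotent_elt mul0r | left; rewrite addr0].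
  + by exists 0, 1; split;
      [exists 1%N | rewrite /idempotent_elt mul1r | left; rewrite add0r].
  + by exists 0, 1; split;
      [exists 1%N | rewrite /idempotent_elt mul1r | right; rewrite sub0r].
Qed.

End Converse.

(** * Pairwise incompatibility of the four conditions *)

Section MutualExclusion.
Local Open Scope ring_scope.
Context (R : comNzRingType) (G : abGroupType).

Lemma torsion_p_group_trivial (p q : nat) :
  coprime p q -> torsion_p_group p G -> torsion_p_group q G -> trivial_group G.
Proof.
move=> pq Gp Gq g.
have [m gm] := in_torsion_component_expg (Gp g).
have [n gn] := in_torsion_component_expg (Gq g).
by apply: expg_coprime_eq1 gm gn; rewrite coprimeXl ?coprimeXr.
Qed.

Lemma neat_case23 : neat_case2 R G -> neat_case3 R G -> False.
Proof.
case=> nt G2 _ [_ G3 _ _]; apply: nt.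
exact: torsion_p_group_trivial G2 G3.
Qed.

(** When [3 = 0], 2 is the unit -1 and cannot be nilpotent. *)
Lemma neat_case24 : neat_case2 R G -> neat_case4 R G -> False.
Proof.
case=> _ _ /nil_clean_nil2 nil2 [_ /ring_isomorphic_F3_cases[h3 _]].
apply: (nilradical_nonunit (b := -1) nil2).
by have -> : 2%:R * -1 = 1 - 3%:R :> R by [ring]; rewrite h3 subr0.
Qed.

Lemma neat_case34 : neat_case3 R G -> neat_case4 R G -> False.
Proof.
case=> _ G3 _ _ [/cyclic_of_order2P[t [t1 tt _]] _].
have [m tm] := in_torsion_component_expg (G3 t).
by apply: t1; apply: expg_coprime_eq1 (tt : (t ^+ 2)%g = 1%g) tm; rewrite coprimeXr.
Qed.

Lemma neat_case4_nontrivial : neat_case4 R G -> ~ trivial_group G.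
Proof. by case=> /cyclic_of_order2P[t [t1 _ _]] _ G1; apply: t1. Qed.

(** The cases exclude one another, so unique existence of the index reduces to a plain
    disjunction. *)
Lemma exactly_one_neat_cases :
  exactly_one [:: neat_case1 R G; neat_case2 R G; neat_case3 R G; neat_case4 R G]
  <-> [\/ neat_case1 R G, neat_case2 R G, neat_case3 R G | neat_case4 R G].
Proof.
split=> [[[[|[|[|[|//]]]] im] [/= Pi _]]|].
- by constructor 1.
- by constructor 2.
- by constructor 3.
- by constructor 4.
have c23 := neat_case23; have c24 := neat_case24; have c34 := neat_case34.
have c4 := neat_case4_nontrivial.
have c12 : neat_case1 R G -> neat_case2 R G -> False by case=> ? _ [].
have c13 : neat_case1 R G -> neat_case3 R G -> False by case=> ? _ [].
have c14 : neat_case1 R G -> neat_case4 R G -> False by case=> ? _ /c4.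
move=> cases; have [i lt_i Pi] : exists2 i, (i < 4)%N & nth False
    [:: neat_case1 R G; neat_case2 R G; neat_case3 R G; neat_case4 R G] i.
  by case: cases; [exists 0%N | exists 1%N | exists 2%N | exists 3%N].
exists (Ordinal lt_i); split=> // -[j lt_j] Pj; apply: val_inj.
move: i j lt_i lt_j Pi Pj {cases}.
by move=> [|[|[|[|i]]]] [|[|[|[|j]]]] //= _ _ Pi Pj; tauto.
Qed.

End MutualExclusion.

Theorem theorem1p4 (R : comNzRingType) (G : abGroupType) :
  [/\ weakly_nil_neat (group_ring R G) <->
        exactly_one [:: neat_case1 R G; neat_case2 R G;
                        neat_case3 R G; neat_case4 R G],
      neat_case2 R G -> boolean_ring {ideal_quot (nilradical R)}
    & neat_case3 R G -> ring_isomorphic {ideal_quot (nilradical R)} 'F_3].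
Proof.
split.
- rewrite exactly_one_neat_cases; split=> [neat|].
    case: (pselect (trivial_group G)) => ntG.
      by constructor 1; split=> //; apply: weakly_nil_neat_image neat; apply: aug_surj.
    case: (nil2_or_nil3 ntG neat) => nilR.
      by constructor 2; apply: weakly_nil_neat_case2.
    by case: (weakly_nil_neat_case34 ntG neat nilR); [constructor 3 | constructor 4].
  case=> [[G1 Rneat]|[_ G2 Rnc]|[_ G3 Rwnc nil3]|].
  + exact: weakly_nil_neat_trivial_group.
  + apply/weakly_nil_clean_neat/(weakly_nil_clean_group_ring (p := 2)) => //.
      exact: nil_clean_nil2.
    exact: nil_clean_weakly.
  + exact/weakly_nil_clean_neat/(weakly_nil_clean_group_ring (p := 3)).
  + exact: weakly_nil_neat_F3_C2.
- by case=> _ _ /nil_clean_quot_boolean.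
- by case=> _ _ Rwnc nil3; apply: weakly_nil_clean_quot_F3.
Qed.
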